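(* Fix $\sigma>0$. There exist finite constants $B_\sigma,N_\sigma$, independent of the spectral level, such that for every Robin eigenvalue $\Lambda\in\operatorname{Spec}(-\Delta_\sigma)$ of the equilateral triangle $T$: (i) for every integer $Q\geq0$, at most $B_\sigma$ desymmetrized modal classes $(m,n)$, $0\le m\le n$, lying on the Neumann shell $m^2+mn+n^2=Q$ contribute to $\Lambda$ (that is, satisfy $\Lambda_{m,n}(\sigma)=\Lambda$); (ii) at most $N_\sigma$ Neumann shells (values of $Q$) contain a modal class contributing to $\Lambda$. In particular, $$K_\sigma:=\sup_{\Lambda\in\operatorname{Spec}(-\Delta_\sigma)}\#\{(m,n)\in\mathbb{Z}^2:\ 0\leq m\leq n,\ \Lambda_{m,n}(\sigma)=\Lambda\}\ \leq\ B_\sigma N_\sigma<\infty .$$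
   Context: Let $r>0$ and let $T$ be the open equilateral triangle with inradius $r$, with vertices $(0,0)$, $(2\sqrt3\,r,0)$, $(\sqrt3\,r,3r)$. For $\sigma\ge0$, $-\Delta_\sigma$ is the Laplacian on $L^2(T)$ with Robin condition $\partial_\nu u+\sigma u=0$ on $\partial T$ ($\nu$ outward unit normal), i.e. the self-adjoint operator of the form $\int_T|\nabla u|^2+\sigma\int_{\partial T}|u|^2\,ds$ on $H^1(T)$. McCartin's parametrization (known): for each pair of integers $0\leq m\leq n$ and each $\sigma\geq0$ there is a unique phase triple $(L,M,N)=(L_{m,n}(\sigma),M_{m,n}(\sigma),N_{m,n}(\sigma))$ with $L\in(-\pi/2,0]$, $M,N\in[0,\pi/2)$, equal to $(0,0,0)$ at $\sigma=0$, solving $$(2L-M-N-(m+n)\pi)\tan L=3r\sigma,\quad (2M-N-L+m\pi)\tan M=3r\sigma,\quad (2N-L-M+n\pi)\tan N=3r\sigma .$$ Set $\mu=m+\frac{2M-N-L}{\pi}$, $\nu=n+\frac{2N-L-M}{\pi}$ and $$\Lambda_{m,n}(\sigma)=\frac{4\pi^2}{27r^2}(\mu^2+\mu\nu+\nu^2).$$ The numbers $\Lambda_{m,n}(\sigma)$, $0\le m\le n$, exhaust $\operatorname{Spec}(-\Delta_\sigma)$. Each pair $(m,n)$ with $0\le m\le n$ indexes one desymmetrized modal class (its symmetric and antisymmetric modes with respect to the altitude are counted as a single class). The Neumann shell of $(m,n)$ is the value $Q=m^2+mn+n^2$; at $\sigma=0$, $\Lambda_{m,n}(0)=\frac{4\pi^2}{27r^2}(m^2+mn+n^2)$.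 *)

(* Defs.v *)
From HB Require Import structures.
From mathcomp Require Import all_boot all_order all_algebra.
From mathcomp Require Import all_classical all_reals all_analysis.

Set Implicit Arguments.
Unset Strict Implicit.
Unset Printing Implicit Defensive.
Import Order.TTheory GRing.Theory Num.Theory.
Import numFieldNormedType.Exports.

Local Open Scope classical_set_scope.
Local Open Scope ring_scope.

Section Robin.
Context {R : realType}.
Implicit Types (r sigma : R) (p : R * R) (u v w : R * R -> R).

Definition vertex r (i : 'I_3) : R * R :=
  match val i with
  | 0%N => (0, 0)
  | 1%N => (2 * Num.sqrt 3 * r, 0)
  | _ => (Num.sqrt 3 * r, 3 * r)
  end.

(* points with positive barycentric coordinates *)
Definition triangle r : set (R * R) :=
  [set p | exists c : 'I_3 -> R,
    [/\ forall i, 0 < c i, \sum_i c i = 1 & p = \sum_i c i *: vertex r i]].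

(* The i-th side, parametrized by t in [0, 1]; a function on the boundary is
   given by a function on the plane, of which only the values at the points
   [edge r i t] matter. *)
Definition edge r (i : 'I_3) (t : R) : R * R :=
  (1 - t) *: vertex r i + t *: vertex r (ordS i).

(* all three sides have length 2 sqrt 3 r *)
Definition boundary_integral r w : R :=
  \sum_(i < 3) 2 * Num.sqrt 3 * r *
    \int[lebesgue_measure]_(t in `[0, 1]) w (edge r i t).

Definition area : {measure set (measurableTypeR R * measurableTypeR R) -> \bar R} :=
  (@lebesgue_measure R \x @lebesgue_measure R)%E.

Definition L2 d (X : measurableType d) (mu : {measure set X -> \bar R})
  (D : set X) (f : X -> R) : Prop := (f \_ D) \in Lfun mu 2%:E.

Definition cvgL2 d (X : measurableType d) (mu : {measure set X -> \bar R})
    (D : set X) (F : nat -> X -> R) (f : X -> R) : Prop :=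
  ('N[mu]_(2%:E)[EFin \o ((F k \- f)%R \_ D)])%E @[k --> \oo] --> 0%E.

Definition axis (i : 'I_2) : R * R := if i == ord0 then (1, 0) else (0, 1).

Fixpoint Ck (k : nat) (phi : R * R -> R) : Prop :=
  continuous phi /\
  if k is k'.+1 then
    forall i, (forall p, derivable phi p (axis i)) /\ Ck k' ('D_(axis i) phi)
  else True.

Definition smooth (phi : R * R -> R) : Prop := forall k, Ck k phi.

Definition test_function r (phi : R * R -> R) : Prop :=
  smooth phi /\
  exists K, [/\ compact K, K `<=` triangle r & forall p, ~ K p -> phi p = 0].

(* u is in H^1(T), with weak gradient G *)
Definition weak_gradient r u (G : 'I_2 -> R * R -> R) : Prop :=
  [/\ L2 area (triangle r) u,
      forall i, L2 area (triangle r) (G i) &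
      forall i phi, test_function r phi ->
        \int[area]_(p in triangle r) (u p * 'D_(axis i) phi p) =
        - \int[area]_(p in triangle r) (G i p * phi p)].

(* w is the boundary trace of u: the continuous extension to H^1(T) of the
   restriction to the boundary of functions smooth up to the boundary *)
Definition trace r u (G : 'I_2 -> R * R -> R) w : Prop :=
  (forall i, L2 lebesgue_measure `[0, 1] (w \o edge r i)) /\
  exists phi : nat -> R * R -> R,
    [/\ forall k, smooth (phi k),
        cvgL2 area (triangle r) phi u,
        forall i, cvgL2 area (triangle r) (fun k => 'D_(axis i) (phi k)) (G i) &
        forall i, cvgL2 lebesgue_measure `[0, 1]
          (fun k => phi k \o edge r i) (w \o edge r i)].

Definition H1 r u G w : Prop := weak_gradient r u G /\ trace r u G w.

(* u is in the domain of the operator of the Robin form, and - Delta_sigma u = f.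
   Weak gradients and traces are unique almost everywhere, so the choice of the
   representatives G, w, H, z does not matter. *)
Definition robin_laplacian r sigma u (f : R * R -> R) : Prop :=
  L2 area (triangle r) f /\
  exists G w, H1 r u G w /\
    forall v H z, H1 r v H z ->
      \int[area]_(p in triangle r) (\sum_i G i p * H i p)
        + sigma * boundary_integral r (fun p => w p * z p)
      = \int[area]_(p in triangle r) (f p * v p).

(* - Delta_sigma - lambda is a bijection from its domain onto L^2(T), functions
   being identified when they agree almost everywhere; as the operator is
   closed, the inverse is then bounded *)
Definition robin_resolvent_set r sigma : set R :=
  [set lambda | forall f, L2 area (triangle r) f ->
    (exists u, robin_laplacian r sigma u (fun p => f p + lambda * u p)) /\
    (forall u v,
       robin_laplacian r sigma u (fun p => f p + lambda * u p) ->
       robin_laplacian r sigma v (fun p => f p + lambda * v p) ->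
       {ae area, forall p, triangle r p -> u p = v p})].

(* only real points are considered, since the operator is self-adjoint *)
Definition robin_spectrum r sigma : set R := ~` robin_resolvent_set r sigma.

Definition is_phase_triple r sigma (m n : nat) (t : R * R * R) : Prop :=
  let: (L, M, N) := t in
  [/\ - (pi / 2) < L <= 0, 0 <= M < pi / 2, 0 <= N < pi / 2,
      sigma = 0 -> t = (0, 0, 0) &
      [/\ (2 * L - M - N - (m + n)%:R * pi) * tan L = 3 * r * sigma,
          (2 * M - N - L + m%:R * pi) * tan M = 3 * r * sigma &
          (2 * N - L - M + n%:R * pi) * tan N = 3 * r * sigma]].

(* For 0 < r, 0 <= sigma and m <= n there is exactly one phase triple, so the
   default value (0, 0, 0) is not used. *)
Definition phase r sigma (m n : nat) : R * R * R :=
  xget (0, 0, 0) [set t | is_phase_triple r sigma m n t].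

Definition Lambda r sigma (m n : nat) : R :=
  let: (L, M, N) := phase r sigma m n in
  let mu := m%:R + (2 * M - N - L) / pi in
  let nu := n%:R + (2 * N - L - M) / pi in
  4 * pi ^+ 2 / (27 * r ^+ 2) * (mu ^+ 2 + mu * nu + nu ^+ 2).

Definition contributing r sigma (lambda : R) : set (nat * nat) :=
  [set mn | (mn.1 <= mn.2)%N /\ Lambda r sigma mn.1 mn.2 = lambda].

Definition shell (mn : nat * nat) : nat :=
  (mn.1 ^ 2 + mn.1 * mn.2 + mn.2 ^ 2)%N.

(* [counting A] is the number of elements of A, +oo if A is infinite *)
Definition Ksup r sigma : \bar R :=
  ereal_sup [set counting (contributing r sigma lambda)
            | lambda in robin_spectrum r sigma].

End Robin.

(* Main.v *)
(* Put rho = 3 r sigma. The quantities kM = pi mu, kN = pi nu, kX = kM + kN and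
   the phases M, N, X = - L satisfy k tan(phase) = rho, whence the identity
     (27 r^2 / 4) Lambda - pi^2 Q
       = 3 (M kM + N kN + X kX) - 9/2 (M^2 + N^2 + X^2) + 3/2 (M + N - X)^2.
   The right-hand side is bounded, so an eigenvalue only sees the shells Q of a
   window of fixed length.  Moreover each phase is rho / (pi a) + O(m^-3) with
   a = m, n, m + n, and expanding the arctangent once more turns the right-hand
   side into
     9 rho - (rho + 3) (rho / pi)^2 S^2 + O(m^-4),
   where S = 1/m + 1/n - 1/(m + n) satisfies S^2 = 1/m^2 + 1/n^2 + 1/(m + n)^2.
   On a shell 1/S = m n (m + n) / Q increases by at least 2 with each unit step
   of m + n; as S is of order 1/m, this gap in S^2 is of order m^-3 and beats
   the error term.  So beyond some m0 the classes of a shell have distinct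
   eigenvalues, and at most m0 classes of the shell have m < m0. *)
Require Import Defs.
From HB Require Import structures.
From mathcomp Require Import all_boot all_order all_algebra.
From mathcomp Require Import all_classical all_reals all_analysis.
From mathcomp Require Import ring lra zify.

Set Implicit Arguments.
Unset Strict Implicit.
Import Order.TTheory GRing.Theory Num.Theory.
Import numFieldNormedType.Exports.
Local Open Scope classical_set_scope.
Local Open Scope card_scope.
Local Open Scope ring_scope.

(** * Taylor bounds of the arctangent on the half-line *)

Section AtanBounds.
Context {R : realType}.
Implicit Types (y : R).

Lemma ge0_of_derive_ge0 (f df : R -> R) y :
  (forall z : R, is_derive z 1 f (df z)) -> (forall z, 0 <= z -> 0 <= df z) ->
  0 <= y -> f 0 <= f y.
Proof.
move=> fdf df_ge0 y_ge0.
have f_cont : {within `[0, y], continuous f}.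
  apply: continuous_subspaceT => z; apply: differentiable_continuous.
  by apply/derivable1_diffP; case: (fdf z).
have [c c_in e] := MVT_segment y_ge0 (fun z _ => fdf z) f_cont.
rewrite -subr_ge0 e mulr_ge0 ?subr0// df_ge0//.
by move: c_in; rewrite in_itv => /andP[].
Qed.

Lemma atan_gt0 y : 0 < y -> 0 < atan y.
Proof. by move=> /lt_atan; rewrite atan0. Qed.

Lemma atan_le_id y : 0 <= y -> atan y <= y.
Proof.
move=> y_ge0; rewrite -subr_ge0.
have := @ge0_of_derive_ge0 (fun z => z - atan z) (fun z => 1 - (1 + z ^+ 2)^-1) y.
rewrite atan0 subrr; apply => // z z_ge0.
by rewrite subr_ge0 invf_le1 ?lerDl ?sqr_ge0// ltr_pwDl// sqr_ge0.
Qed.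

(** The derivatives of the two sides differ by [z^4 / (1 + z^2)]; in the quintic bound below, by
    [z^6 / (1 + z^2)]. *)
Lemma atan_ge_cubic y : 0 <= y -> y - y ^+ 3 / 3 <= atan y.
Proof.
move=> y_ge0; rewrite -subr_ge0.
have := @ge0_of_derive_ge0 (fun z => atan z - (z - z ^+ 3 / 3))
  (fun z => (1 + z ^+ 2)^-1 - (1 - z ^+ 2)) y.
rewrite atan0 expr0n/= mul0r !subr0; apply => // z.
  apply: is_derive_eq.
  by rewrite ?scaler1 ?scaler0 /GRing.scale/=; move: ((1 + z ^+ 2)^-1) => w; field.
move=> z_ge0; rewrite subr_ge0 -[X in _ <= X]mul1r ler_pdivlMr.
  by have := exprn_ge0 4 z_ge0; nra.
by rewrite ltr_pwDl// sqr_ge0.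
Qed.

Lemma atan_le_quintic y : 0 <= y -> atan y <= y - y ^+ 3 / 3 + y ^+ 5 / 5.
Proof.
move=> y_ge0; rewrite -subr_ge0.
have := @ge0_of_derive_ge0 (fun z => (z - z ^+ 3 / 3 + z ^+ 5 / 5) - atan z)
  (fun z => (1 - z ^+ 2 + z ^+ 4) - (1 + z ^+ 2)^-1) y.
rewrite atan0 !expr0n/= !mul0r !subr0 addr0; apply => // z.
  apply: is_derive_eq.
  by rewrite ?scaler1 ?scaler0 /GRing.scale/=; move: ((1 + z ^+ 2)^-1) => w; field.
move=> z_ge0; rewrite subr_ge0 -[X in X <= _]mul1r ler_pdivrMr.
  by have := exprn_ge0 6 z_ge0; nra.
by rewrite ltr_pwDl// sqr_ge0.
Qed.

End AtanBounds.

(** * The phase as a function of the wavenumber, and existence of phase triples *)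

Section PhaseOfWavenumber.
Context {R : realType} (rho : R).
Hypothesis rho_gt0 : 0 < rho.

(* [arctan (rho / k)] for [k > 0], extended continuously to all [k]. *)
Definition arccot_phase (k : R) : R := pi / 2 - atan (k / rho).

Lemma arccot_phase_gt0 k : 0 < arccot_phase k.
Proof. by rewrite subr_gt0 atan_ltpi2. Qed.

Lemma arccot_phase_lt k : 0 < k -> arccot_phase k < pi / 2.
Proof.
by move=> k_gt0; rewrite /arccot_phase ltrBlDr ltrDl atan_gt0// divr_gt0.
Qed.

Lemma le_arccot_phase k k' : k <= k' -> arccot_phase k' <= arccot_phase k.
Proof. by move=> kk'; rewrite lerD2l lerN2 le_atan// ler_pM2r// invr_gt0. Qed.

Lemma tan_arccot_phase k : 0 < k -> k * tan (arccot_phase k) = rho.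
Proof.
move=> k_gt0; rewrite /tan /arccot_phase sinB cosB sin_pihalf cos_pihalf.
rewrite !(mul1r, mul0r, addr0, add0r, subr0).
rewrite -[X in k * X = _]invrK invf_div -/(tan _) atanK.
by rewrite invf_div mulrCA mulfV ?mulr1// gt_eqF.
Qed.

Lemma continuous_arccot_phase : continuous arccot_phase.
Proof.
move=> k; apply: cvgB; first exact: cvg_cst.
apply: (@continuous_comp _ _ _ (fun k : R => k / rho) atan).
  exact: mulrr_continuous.
exact: continuous_atan.
Qed.

(** With [s = L + M + N], the wavenumber [k = 2 M - N - L + m pi] equals [3 M + m pi - s], so the
    equation for [M] becomes [defect k = m pi - s]: fixing [s] decouples the unknowns. *)
Definition defect (k : R) : R := k - 3 * arccot_phase k.

(** The phase decreases in [k]. Hence an inverse of [defect] is 1-Lipschitz. *)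
Lemma defect_expanding k k' : k <= k' -> k' - k <= defect k' - defect k.
Proof. by move=> kk'; have := le_arccot_phase kk'; rewrite /defect; lra. Qed.

Lemma defect_surj A : exists k, defect k = A.
Proof.
(* The phase at [b] is at most [pi / 2], so [defect b >= |A|], while [defect (- b) < - b <= A]. *)
pose b := `|A| + 3 * (pi / 2).
have b_ge0 : 0 <= b by rewrite addr_ge0// mulr_ge0// divr_ge0// pi_ge0.
have [k _ <-] : exists2 k, k \in `[- b, b] & defect k = A; last by exists k.
apply: IVT; first by lra.
  apply: continuous_subspaceT => k; apply: cvgB; first exact: cvg_id.
  by apply: cvgM; [exact: cvg_cst|exact: continuous_arccot_phase].
have x_gt0 := arccot_phase_gt0 (- b).
have x_le : arccot_phase b <= pi / 2.
  by rewrite lerBlDr lerDl -[X in X <= _]atan0 le_atan// divr_ge0// ltW.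
have A_le := ler_norm A; have NA_le := ler_norm (- A); rewrite normrN in NA_le.
have pi0 := pi_gt0 R.
rewrite ge_min le_max /defect; apply/andP; split; apply/orP; [left|right].
  by rewrite {1}/b; lra.
by rewrite {1}/b; lra.
Qed.

End PhaseOfWavenumber.

(* Given s = L + M + N, the wavenumbers kM, kN solve [defect k = pi a - s],
   a = m, n; the remaining condition on s is met by the intermediate value
   theorem on [0, pi]. *)
Lemma is_phase_triple_exists (R : realType) (r sigma : R) (m n : nat) :
  0 < r -> 0 < sigma -> exists t, is_phase_triple r sigma m n t.
Proof.
move=> r_gt0 sigma_gt0; pose rho := 3 * r * sigma.
have rho_gt0 : 0 < rho by rewrite !mulr_gt0.
pose x := arccot_phase rho; pose g := defect rho.
have [h hK] : {h : R -> R & cancel h g}.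
  by exists (fun A => sval (cid (defect_surj rho_gt0 A))) => A; case: cid.
have h_lip A A' : `|h A - h A'| <= `|A - A'|.
  wlog hAA' : A A' / h A <= h A' => [wh|].
    have [|/ltW] := leP (h A) (h A'); first exact: wh.
    by move=> /wh; rewrite distrC [X in _ <= X]distrC.
  have := defect_expanding rho_gt0 hAA'; rewrite -/g !hK => hle.
  rewrite distrC ger0_norm ?subr_ge0// distrC.
  exact: le_trans hle (ler_norm _).
have h_cont : continuous h.
  move=> A; apply/cvgrPdist_le => e e0; near=> A'.
  by apply: le_trans (h_lip _ _) _; near: A'; apply: cvgr_dist_le e0; exact: cvg_id.
have pi0 := pi_gt0 R.
(* At [k = 0] the defect is [- 3 pi / 2 < - pi]. As [m pi - s >= - pi] for [s <= pi], the
   wavenumbers below are positive. *)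
have h_gt0 (A : R) : - pi <= A -> 0 < h A.
  move=> A_ge; rewrite ltNge; apply/negP => hA_le0.
  have := defect_expanding rho_gt0 hA_le0; rewrite -/g hK.
  by rewrite /g /defect /arccot_phase mul0r atan0; lra.
pose kM s := h (m%:R * pi - s); pose kN s := h (n%:R * pi - s).
have k_cont (p : nat) : continuous (fun s => h (p%:R * pi - s)).
  move=> s; apply: (@continuous_comp _ _ _ (fun s : R => p%:R * pi - s) h).
    by apply: cvgB; [exact: cvg_cst|exact: cvg_id].
  exact: h_cont.
have x_cont (k : R -> R) : continuous k -> continuous (x \o k).
  by move=> kc s; apply: continuous_comp; [exact: kc|exact: continuous_arccot_phase].
have k_gt0 (p : nat) s : s <= pi -> 0 < h (p%:R * pi - s).
  move=> s_le; apply: h_gt0; have : 0 <= p%:R * (pi : R) by rewrite mulr_ge0 // ltW.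
  by lra.
(* The third wavenumber is [kM + kN], so [L = - x (kM + kN)], and a zero of [F] means
   [s = L + M + N]. [F] is negative at [pi] because phases stay below [pi / 2], and positive at [0]
   because they decrease in [k]. *)
pose F s := x (kM s) + x (kN s) - x (kM s + kN s) - s.
have [s s_in F0] : exists2 s, s \in `[0, pi] & F s = 0.
  apply: IVT; first exact: ltW.
    apply: continuous_subspaceT => s.
    apply: cvgB; last exact: cvg_id.
    apply: cvgB; last first.
      by apply: (x_cont (fun s => kM s + kN s)) => {}s; apply: cvgD; exact: k_cont.
    by apply: cvgD; apply: x_cont; exact: k_cont.
  rewrite ge_min le_max /F; apply/andP; split; apply/orP; [right|left].
    have := arccot_phase_lt rho_gt0 (k_gt0 m pi (lexx _)).
    have := arccot_phase_lt rho_gt0 (k_gt0 n pi (lexx _)).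
    have := arccot_phase_gt0 rho (kM pi + kN pi).
    rewrite -/(kM pi) -/(kN pi) -/x; lra.
  have kM_ge0 := ltW (k_gt0 m 0 (ltW pi0)).
  have : x (kM 0 + kN 0) <= x (kN 0) by apply: le_arccot_phase => //; rewrite lerDr.
  have := arccot_phase_gt0 rho (kM 0); rewrite -/x; lra.
have s_le : s <= pi by move: s_in; rewrite in_itv => /andP[].
have kM0 : 0 < kM s := k_gt0 m s s_le.
have kN0 : 0 < kN s := k_gt0 n s s_le.
have kL0 : 0 < kM s + kN s by rewrite addr_gt0.
have gM : kM s - 3 * x (kM s) = m%:R * pi - s := hK _.
have gN : kN s - 3 * x (kN s) = n%:R * pi - s := hK _.
have F0' : x (kM s) + x (kN s) - x (kM s + kN s) - s = 0 := F0.
exists (- x (kM s + kN s), x (kM s), x (kN s)).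
have xbound (k : R) : 0 < k -> 0 < x k < pi / 2.
  by move=> k0; rewrite arccot_phase_gt0 arccot_phase_lt.
have /andP[xM xM'] := xbound _ kM0; have /andP[xN xN'] := xbound _ kN0.
have /andP[xL xL'] := xbound _ kL0.
split.
- by rewrite ltrN2 xL' oppr_le0 ltW.
- by rewrite xM' ltW.
- by rewrite xN' ltW.
- by move=> sigma0; rewrite sigma0 ltxx in sigma_gt0.
rewrite tanN -/rho natrD; split.
- have -> : 2 * - x (kM s + kN s) - x (kM s) - x (kN s) - (m%:R + n%:R) * pi
    = - (kM s + kN s) by lra.
  by rewrite mulrNN; exact: tan_arccot_phase.
- have -> : 2 * x (kM s) - x (kN s) - - x (kM s + kN s) + m%:R * pi = kM s by lra.
  exact: tan_arccot_phase.
- have -> : 2 * x (kN s) - - x (kM s + kN s) - x (kM s) + n%:R * pi = kN s by lra.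
  exact: tan_arccot_phase.
Unshelve. all: by end_near. Qed.

(** * Asymptotics of a single phase *)

Section ModeExpansion.
Context {R : realType} (rho : R).
Hypothesis rho_gt0 : 0 < rho.
Implicit Types (a k x : R).

(** Since [rho > 0] rules out [x = 0], both [tan x] and [k] are positive and the equation can be
    inverted. *)
Lemma phase_atan k x : 0 <= x < pi / 2 -> k * tan x = rho ->
  [/\ 0 < k, 0 < x & x = atan (rho / k)].
Proof.
move=> /andP[x_ge0 x_lt] ktan.
have x_in : x \in `](- (pi / 2)), (pi / 2)[.
  by rewrite in_itv/= x_lt andbT (lt_le_trans _ x_ge0)// oppr_lt0 divr_gt0 ?pi_gt0.
have x_gt0 : 0 < x.
  rewrite lt_neqAle x_ge0 andbT; apply/eqP => x0.
  by move: rho_gt0; rewrite -ktan -x0 tan0 mulr0 ltxx.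
have tan_gt0 : 0 < tan x.
  rewrite -tan0 ltr_tan// in_itv/= oppr_lt0 andbb.
  by rewrite divr_gt0// pi_gt0.
have k_gt0 : 0 < k by rewrite -(pmulr_lgt0 _ tan_gt0) ktan.
by split; rewrite // -ktan mulrAC divff ?gt_eqF// mul1r tanK.
Qed.

Lemma phase_mul_bound k x : 0 <= x < pi / 2 -> k * tan x = rho ->
  0 <= x * k <= rho.
Proof.
move=> x_in /(phase_atan x_in)[k_gt0 x_gt0 ->].
have y_ge0 : 0 <= rho / k by rewrite divr_ge0// ltW.
have atan_ge0 : 0 <= atan (rho / k) by rewrite -[leLHS]atan0 le_atan.
by rewrite mulr_ge0 ?(ltW k_gt0)//= -ler_pdivlMr// atan_le_id.
Qed.

Lemma phase_expansion k x : 0 <= x < pi / 2 -> k * tan x = rho ->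
  [/\ 0 < k, 0 <= x <= rho / k, `|x - rho / k| <= (rho / k) ^+ 3 &
    `|x * k - rho + rho * (rho / k) ^+ 2 / 3| <= rho * (rho / k) ^+ 4].
Proof.
move=> x_in /(phase_atan x_in)[k_gt0 x_gt0 xE].
set y := rho / k in xE *.
have y_ge0 : 0 <= y by rewrite divr_ge0// ltW.
have := atan_le_id y_ge0; have := atan_ge_cubic y_ge0.
have := atan_le_quintic y_ge0; rewrite -xE => le5 ge3 le1.
have y3 := exprn_ge0 3 y_ge0; have y4 := exprn_ge0 4 y_ge0.
split; rewrite ?(ltW x_gt0)//; rewrite ler_norml; first by apply/andP; split; lra.
have rhoE : rho = y * k by rewrite divfK// gt_eqF.
have -> : x * k - rho + rho * y ^+ 2 / 3 = k * (x - (y - y ^+ 3 / 3)).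
  by rewrite rhoE; field.
have -> : rho * y ^+ 4 = k * y ^+ 5 by rewrite rhoE; ring.
have y5 := exprn_ge0 5 y_ge0.
by rewrite -mulrN !ler_pM2l//; apply/andP; split; lra.
Qed.

(** Replaces [k] by its phase-free part [a]: the difference
    [rho / k - rho / a = rho (a - k) / (a k)] is of order [eps^3], like the Taylor error. It is
    applied with [eps = 1 / m]. *)
Lemma mode_expansion eps a k x : 0 <= x < pi / 2 -> k * tan x = rho ->
  0 < a -> a^-1 <= eps -> k^-1 <= eps -> `|k - a| <= 4 * (rho * eps) ->
  `|x - rho / a| <= (4 * rho ^+ 2 + rho ^+ 3) * eps ^+ 3 /\
  `|x * k - rho + rho * (rho / a) ^+ 2 / 3|
    <= (rho ^+ 5 + 3 * rho ^+ 4) * eps ^+ 4.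
Proof.
move=> x_in ktan a_gt0 a_eps k_eps ka.
have [k_gt0 x_le xy xk] := phase_expansion x_in ktan.
set y := rho / k in x_le xy xk; set z := rho / a.
have eps_ge0 : 0 <= eps by apply: le_trans a_eps; rewrite invr_ge0 ltW.
have rho_ge0 := ltW rho_gt0.
have y_ge0 : 0 <= y by rewrite divr_ge0// ltW.
have z_ge0 : 0 <= z by rewrite divr_ge0// ltW.
have y_le : y <= rho * eps by rewrite ler_wpM2l.
have z_le : z <= rho * eps by rewrite ler_wpM2l.
have yz : `|y - z| <= 4 * rho ^+ 2 * eps ^+ 3.
  have -> : y - z = rho * (- (k - a) * (a^-1 * k^-1)).
    by rewrite /y /z; field; rewrite !gt_eqF//.
  have -> : 4 * rho ^+ 2 * eps ^+ 3 = rho * (4 * (rho * eps) * (eps * eps)) by ring.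
  rewrite normrM ger0_norm// ler_wpM2l// normrM normrN ler_pM//.
  by rewrite ger0_norm ?ler_pM ?mulr_ge0 ?invr_ge0// ltW.
have yn (n : nat) : y ^+ n <= rho ^+ n * eps ^+ n.
  by rewrite -exprMn lerXn2r ?nnegrE//; exact: mulr_ge0.
split.
  have -> : x - z = (x - y) + (y - z) by ring.
  rewrite (le_trans (ler_normD _ _))// mulrDl addrC lerD//.
  exact: le_trans xy (yn 3).
have -> : x * k - rho + rho * z ^+ 2 / 3 =
    (x * k - rho + rho * y ^+ 2 / 3) - rho / 3 * ((y - z) * (y + z)).
  by field.
rewrite (le_trans (ler_normB _ _))// [leRHS]mulrDl lerD//.
  apply: le_trans xk _; have -> : rho ^+ 5 * eps ^+ 4 = rho * (rho ^+ 4 * eps ^+ 4) by ring.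
  by rewrite ler_wpM2l.
(* [y + z <= 2 rho eps]; enlarging 2 to 9/4 makes the constant the integer 3. *)
have -> : 3 * rho ^+ 4 * eps ^+ 4 =
    rho / 3 * ((4 * rho ^+ 2 * eps ^+ 3) * ((9 / 4) * (rho * eps))) by field.
rewrite normrM ger0_norm ?divr_ge0// ler_wpM2l ?divr_ge0// normrM ler_pM//.
rewrite ger0_norm ?addr_ge0//; nra.
Qed.

End ModeExpansion.

(** Times [rho / pi], the leading term of [M + N - X]; it also equals [Q / (m n (m + n))]. *)
Definition harmonic_gap {R : realType} (m n : nat) : R :=
  m%:R^-1 + n%:R^-1 - (m + n)%:R^-1.

(** * The shift of an eigenvalue away from its Neumann value *)

Section PhaseTriple.
Context {R : realType} (rho : R) (m n : nat) (X M N : R).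
Hypothesis rho_gt0 : 0 < rho.

(* [X] stands for [- L], which makes the three phases and the three
   wavenumbers [kX = kM + kN], [kM], [kN] nonnegative. *)
Let kM := 2 * M - N + X + m%:R * pi.
Let kN := 2 * N - M + X + n%:R * pi.
Let kX := 2 * X + M + N + (m + n)%:R * pi.

Hypotheses (X_in : 0 <= X < pi / 2) (M_in : 0 <= M < pi / 2)
  (N_in : 0 <= N < pi / 2).
Hypotheses (eqX : kX * tan X = rho) (eqM : kM * tan M = rho)
  (eqN : kN * tan N = rho).

Definition excess : R := kM ^+ 2 + kM * kN + kN ^+ 2
  - pi ^+ 2 * (m ^ 2 + m * n + n ^ 2)%N%:R.

(** Trades the large squares of wavenumbers for the phases and the products phase times wavenumber,
    which lie in [[0, rho]]. *)
Lemma excessE : excess = 3 * (M * kM + N * kN + X * kX)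
  - 9 / 2 * (M ^+ 2 + N ^+ 2 + X ^+ 2) + 3 / 2 * (M + N - X) ^+ 2.
Proof.
by rewrite /excess /kM /kN /kX !natrD natrM !natrX; field.
Qed.

Lemma excess_bound : `|excess| <= 9 * rho + 27 / 2 * pi ^+ 2.
Proof.
have /andP[XkX XkX'] := phase_mul_bound rho_gt0 X_in eqX.
have /andP[MkM MkM'] := phase_mul_bound rho_gt0 M_in eqM.
have /andP[NkN NkN'] := phase_mul_bound rho_gt0 N_in eqN.
have /andP[X0 X1] := X_in; have /andP[M0 M1] := M_in; have /andP[N0 N1] := N_in.
have pi0 := pi_gt0 R.
have sq (x : R) : 0 <= x -> x < pi / 2 -> 0 <= x ^+ 2 <= pi ^+ 2.
  by move=> ? ?; rewrite sqr_ge0 lerXn2r ?nnegrE//; lra.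
have /andP[X2 X2'] := sq _ X0 X1; have /andP[M2 M2'] := sq _ M0 M1.
have /andP[N2 N2'] := sq _ N0 N1.
have s2 : 0 <= (M + N - X) ^+ 2 <= pi ^+ 2.
  rewrite sqr_ge0 -real_normK ?num_real// lerXn2r ?nnegrE ?(ltW pi0)//.
  by rewrite ler_norml; apply/andP; split; lra.
have /andP[s20 s21] := s2.
by rewrite excessE ler_norml; apply/andP; split; lra.
Qed.

Hypotheses (m_gt0 : (0 < m)%N) (mn : (m <= n)%N).

(** With [z = rho / (pi a)], a product contributes [rho - rho z^2 / 3]. The last square in [excessE]
    is to leading order the sum of the three [z^2], so [- 9/2 + 3/2 = - 3] and the total coefficient
    is [- (rho + 3)]. *)
Lemma excess_expansion :
  `|excess - 9 * rho + (rho + 3) * (rho / pi) ^+ 2 * harmonic_gap m n ^+ 2|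
  <= (9 * (rho ^+ 5 + 3 * rho ^+ 4) + 54 * rho * (4 * rho ^+ 2 + rho ^+ 3))
     * m%:R^-1 ^+ 4.
Proof.
set eps : R := m%:R^-1.
have pi0 := pi_gt0 R; have pi2 : 2 <= pi :> R by have := @pihalf_ge1 R; lra.
have [kX0 X_le _ _] := phase_expansion rho_gt0 X_in eqX.
have [kM0 M_le _ _] := phase_expansion rho_gt0 M_in eqM.
have [kN0 N_le _ _] := phase_expansion rho_gt0 N_in eqN.
have /andP[X0 X1] := X_in; have /andP[M0 M1] := M_in; have /andP[N0 N1] := N_in.
have m1 : 1 <= m%:R :> R by rewrite ler1n.
have mn' : m%:R <= n%:R :> R by rewrite ler_nat.
have m0 : 0 < m%:R :> R by lra.
(* A subtracted phase costs less than [pi / 2]; as [pi >= 2] and [m >= 1], every wavenumber is still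
   at least [m]. *)
have pim (t : R) : m%:R <= t -> m%:R <= t * pi - pi / 2 /\ m%:R <= t * pi by nra.
have inv_eps (k : R) : m%:R <= k -> k^-1 <= eps.
  by move=> mk; rewrite lef_pV2// posrE; lra.
have kM_eps : kM^-1 <= eps.
  by apply: inv_eps; have [] := pim m%:R (lexx _); rewrite /kM; lra.
have kN_eps : kN^-1 <= eps.
  by apply: inv_eps; have [] := pim n%:R mn'; rewrite /kN; lra.
have mnR : m%:R <= (m + n)%:R :> R by rewrite ler_nat leq_addr.
have kX_eps : kX^-1 <= eps.
  by apply: inv_eps; have [] := pim (m + n)%:R mnR; rewrite /kX; lra.
have le_eps (x k : R) : k^-1 <= eps -> 0 <= x <= rho / k -> x <= rho * eps.
  by move=> ke /andP[_ /le_trans]; apply; rewrite ler_wpM2l// ltW.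
have {}X_le := le_eps _ _ kX_eps X_le.
have {}M_le := le_eps _ _ kM_eps M_le.
have {}N_le := le_eps _ _ kN_eps N_le.
have [_ am] := pim m%:R (lexx _); have [_ an] := pim n%:R mn'.
have [_ ax] := pim (m + n)%:R mnR.
(* The phases, each at most [rho eps], have coefficients of total size 2 + 1 + 1 = 4. *)
have dM : `|kM - m%:R * pi| <= 4 * (rho * eps).
  by rewrite /kM addrK ler_norml; apply/andP; split; lra.
have dN : `|kN - n%:R * pi| <= 4 * (rho * eps).
  by rewrite /kN addrK ler_norml; apply/andP; split; lra.
have dX : `|kX - (m + n)%:R * pi| <= 4 * (rho * eps).
  by rewrite /kX addrK ler_norml; apply/andP; split; lra.
have [M_z Mk_z] :=
  mode_expansion rho_gt0 M_in eqM (lt_le_trans m0 am) (inv_eps _ am) kM_eps dM.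
have [N_z Nk_z] :=
  mode_expansion rho_gt0 N_in eqN (lt_le_trans m0 an) (inv_eps _ an) kN_eps dN.
have [X_z Xk_z] :=
  mode_expansion rho_gt0 X_in eqX (lt_le_trans m0 ax) (inv_eps _ ax) kX_eps dX.
have z_le (t : R) : m%:R <= t * pi -> 0 <= rho / (t * pi) <= rho * eps.
  move=> tp; rewrite divr_ge0 ?(ltW rho_gt0)//=; last by lra.
  by rewrite ler_wpM2l ?(ltW rho_gt0)// inv_eps.
have /andP[zM0 zM1] := z_le _ am; have /andP[zN0 zN1] := z_le _ an.
have /andP[zX0 zX1] := z_le _ ax.
set zM := rho / (m%:R * pi) in M_z Mk_z zM0 zM1.
set zN := rho / (n%:R * pi) in N_z Nk_z zN0 zN1.
set zX := rho / ((m + n)%:R * pi) in X_z Xk_z zX0 zX1.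
have harmE : rho / pi * harmonic_gap m n = zM + zN - zX.
  by rewrite /harmonic_gap /zM /zN /zX !invfM; ring.
(* Cross terms cancel: [1/zX = 1/zM + 1/zN] gives [zM zN = zX (zM + zN)]. *)
have harm2 : (zM + zN - zX) ^+ 2 = zM ^+ 2 + zN ^+ 2 + zX ^+ 2.
  by rewrite /zM /zN /zX natrD; field; rewrite !gt_eqF//; lra.
pose C := 4 * rho ^+ 2 + rho ^+ 3; rewrite -/C in M_z N_z X_z *.
have sq_diff (B b x z : R) : `|x - z| <= B * (C * eps ^+ 3) ->
    `|x + z| <= b * (rho * eps) -> `|x ^+ 2 - z ^+ 2| <= B * b * (rho * C) * eps ^+ 4.
  move=> xz xz'; rewrite subr_sqr normrM.
  apply: le_trans (ler_pM _ _ xz xz') _ => //.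
  by rewrite le_eqVlt; apply/orP; left; apply/eqP; ring.
have sq1 (x z : R) : 0 <= x -> x <= rho * eps -> 0 <= z -> z <= rho * eps ->
    `|x - z| <= C * eps ^+ 3 -> `|x ^+ 2 - z ^+ 2| <= 1 * 2 * (rho * C) * eps ^+ 4.
  by move=> ? ? ? ? ?; apply: (sq_diff 1 2); rewrite ?mul1r// ger0_norm; lra.
have M2 := sq1 _ _ M0 M_le zM0 zM1 M_z.
have N2 := sq1 _ _ N0 N_le zN0 zN1 N_z.
have X2 := sq1 _ _ X0 X_le zX0 zX1 X_z.
have s2 : `|(M + N - X) ^+ 2 - (zM + zN - zX) ^+ 2| <= 3 * 6 * (rho * C) * eps ^+ 4.
  apply: (sq_diff 3 6); move: M_z N_z X_z; rewrite !ler_norml;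
  by move=> /andP[? ?] /andP[? ?] /andP[? ?]; apply/andP; split; lra.
(* The squares contribute 9/2 times three errors [2 rho C] and 3/2 times [18 rho C], in all
   [54 rho C]. *)
have -> : excess - 9 * rho + (rho + 3) * (rho / pi) ^+ 2 * harmonic_gap m n ^+ 2 =
    3 * ((M * kM - rho + rho * zM ^+ 2 / 3) + (N * kN - rho + rho * zN ^+ 2 / 3)
      + (X * kX - rho + rho * zX ^+ 2 / 3))
    - 9 / 2 * ((M ^+ 2 - zM ^+ 2) + (N ^+ 2 - zN ^+ 2) + (X ^+ 2 - zX ^+ 2))
    + 3 / 2 * ((M + N - X) ^+ 2 - (zM + zN - zX) ^+ 2).
  by rewrite excessE -[_ * harmonic_gap m n ^+ 2]mulrA -exprMn harmE harm2; field.
move: M2 N2 X2 s2 Mk_z Nk_z Xk_z; rewrite !ler_norml.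
move=> /andP[? ?] /andP[? ?] /andP[? ?] /andP[? ?] /andP[? ?] /andP[? ?] /andP[? ?].
by apply/andP; split; lra.
Qed.

End PhaseTriple.

(** * Arithmetic of the shells, and cardinality tools *)

Section Lattice.
Context {R : realType}.
Implicit Types (m n : nat).
Local Notation gap := (@harmonic_gap R).

(** Since [m n = (m + n)^2 - Q], the sum and the product of the pair are known. *)
Lemma shell_sum_inj m n m' n' : (m <= n)%N -> (m' <= n')%N ->
  shell (m, n) = shell (m', n') -> (m + n = m' + n')%N -> (m, n) = (m', n').
Proof.
rewrite /shell/= => mn mn' eqQ eqS.
have eqP : (m * n = m' * n')%N by nia.
by congr pair; nia.
Qed.

Lemma shell_fst_inj m n n' : shell (m, n) = shell (m, n') -> n = n'.
Proof. by rewrite /shell/=; nia. Qed.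

Lemma harmonic_gap_bounds m n : (0 < m)%N -> (m <= n)%N ->
  m%:R^-1 <= gap m n <= 2 * m%:R^-1.
Proof.
move=> m0 mn; have mR : 0 < m%:R :> R by rewrite ltr0n.
have nm : n%:R^-1 <= m%:R^-1 :> R.
  by rewrite lef_pV2 ?posrE ?ltr0n ?ler_nat// (leq_trans m0).
have sn : (m + n)%:R^-1 <= n%:R^-1 :> R.
  by rewrite lef_pV2 ?posrE ?ltr0n ?ler_nat ?leq_addl// ?addn_gt0 ?m0// (leq_trans m0).
have s0 : 0 <= (m + n)%:R^-1 :> R by rewrite invr_ge0.
by rewrite /harmonic_gap; apply/andP; split; lra.
Qed.

(* With [v = m + n] and [Q] the shell, [mn(m + n) = v(v^2 - Q)], and [v^2 >= Q]:
   on a shell this cubic grows by at least [2Q] at each unit step of [v]. *)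
Lemma harmonic_gap_sep m n m' n' : (0 < m)%N -> (0 < n)%N -> (0 < m')%N ->
  (0 < n')%N -> shell (m, n) = shell (m', n') -> (m + n < m' + n')%N ->
  2 * gap m n * gap m' n' <= gap m n - gap m' n'.
Proof.
move=> m0 n0 m0' n0' eqQ lt_sum.
have {}eqQ : (shell (m, n))%:R = (shell (m', n'))%:R :> R by rewrite eqQ.
have {}lt_sum : m%:R + n%:R + 1 <= m'%:R + n'%:R :> R.
  by rewrite -natrD natr1 -natrD ler_nat.
have gapE (a b : nat) : (0 < a)%N -> (0 < b)%N ->
    gap a b = (shell (a, b))%:R / (a%:R * b%:R * (a%:R + b%:R)).
  move=> a0 b0; rewrite /harmonic_gap /shell/= !natrD natrM !natrX.
  have a0R : 0 < a%:R :> R by rewrite ltr0n.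
  have b0R : 0 < b%:R :> R by rewrite ltr0n.
  by field; rewrite !gt_eqF ?addr_gt0.
rewrite !gapE// -eqQ; set q : R := (shell (m, n))%:R.
have qE : q = m%:R ^+ 2 + m%:R * n%:R + n%:R ^+ 2 by rewrite /q !natrD natrM !natrX.
have qE' : q = m'%:R ^+ 2 + m'%:R * n'%:R + n'%:R ^+ 2.
  by rewrite /q eqQ !natrD natrM !natrX.
have mR : 0 < m%:R :> R by rewrite ltr0n.
have nR : 0 < n%:R :> R by rewrite ltr0n.
have mR' : 0 < m'%:R :> R by rewrite ltr0n.
have nR' : 0 < n'%:R :> R by rewrite ltr0n.
move: m%:R n%:R m'%:R n'%:R mR nR mR' nR' lt_sum qE qE' => a b a' b'.
move=> a0 b0 a0' b0' vv' qE qE'.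
have ab : a * b = (a + b) ^+ 2 - q by rewrite qE; ring.
have ab' : a' * b' = (a' + b') ^+ 2 - q by rewrite qE'; ring.
have q0 : 0 < q by rewrite qE; nra.
have p0 : 0 < a * b * (a + b) by rewrite !mulr_gt0 ?addr_gt0.
have p0' : 0 < a' * b' * (a' + b') by rewrite !mulr_gt0 ?addr_gt0.
(* Divided by [q], this says that [1 / gap] grows by at least 2; multiplying by both gaps gives the
   claim. *)
have key : 2 * q <= a' * b' * (a' + b') - a * b * (a + b).
  have v2 : q <= (a + b) ^+ 2 by rewrite -subr_ge0 -ab mulr_ge0 ?ltW.
  have v0 : 0 < a + b by rewrite addr_gt0.
  rewrite ab ab'; move: (a + b) (a' + b') v0 vv' v2 => v v' v0 vv' v2.
  have -> : (v' ^+ 2 - q) * v' - (v ^+ 2 - q) * v =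
      (v' - v) * (v' ^+ 2 + v * v' + v ^+ 2 - q) by ring.
  have : 2 * q <= v' ^+ 2 + v * v' + v ^+ 2 - q by nra.
  by nra.
rewrite -subr_ge0.
have -> : q / (a * b * (a + b)) - q / (a' * b' * (a' + b')) -
    2 * (q / (a * b * (a + b))) * (q / (a' * b' * (a' + b'))) =
    q * (a' * b' * (a' + b') - a * b * (a + b) - 2 * q)
    / (a * b * (a + b) * (a' * b' * (a' + b'))).
  by field; rewrite !gt_eqF ?addr_gt0.
apply: divr_ge0; last by rewrite ltW// mulr_gt0.
by apply: mulr_ge0; [exact: ltW|rewrite subr_ge0].
Qed.

(** [T] and [T'] stand for the gaps of two classes with the same scaled eigenvalue [E]. The
    expansions force [c1 (T^2 - T'^2) <= 2 D T^4], but the separation gives [T^2 - T'^2 >= T^3]. *)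
Lemma expansion_separates (E c0 c1 D T T' : R) : 0 < c1 -> 0 <= D ->
  0 < T -> 0 < T' -> T <= 1 / 2 -> 2 * D * T < c1 -> 2 * T * T' <= T - T' ->
  `|E - c0 + c1 * T ^+ 2| <= D * T ^+ 4 ->
  `|E - c0 + c1 * T' ^+ 2| <= D * T' ^+ 4 -> False.
Proof.
move=> c1_gt0 D_ge0 T0 T0' T_le DT gapTT'; rewrite !ler_norml.
move=> /andP[? ?] /andP[? ?].
(* [T' <= T / (1 + 2 T)] yields [T - T' >= 2 T^2 / (1 + 2 T)], and [T <= 1/2]. *)
have gap2 : T ^+ 2 <= T - T'.
  have h : T' * (1 + 2 * T) <= T by nra.
  have : T ^+ 2 * (1 + 2 * T) <= (T - T') * (1 + 2 * T) by nra.
  by rewrite ler_pM2r//; lra.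
have TT' : T' <= T by nra.
have sq_gap : T ^+ 3 <= T ^+ 2 - T' ^+ 2.
  have -> : T ^+ 3 = T * T ^+ 2 by ring.
  by nra.
have T4 : T' ^+ 4 <= T ^+ 4 by rewrite lerXn2r ?nnegrE// ltW.
have up : c1 * (T ^+ 2 - T' ^+ 2) <= 2 * D * T ^+ 4.
  have : D * T' ^+ 4 <= D * T ^+ 4 by rewrite ler_wpM2l.
  by lra.
have : 2 * D * T ^+ 4 < c1 * T ^+ 3.
  have -> : 2 * D * T ^+ 4 = 2 * D * T * T ^+ 3 by ring.
  by rewrite ltr_pM2r// exprn_gt0.
apply/negP; rewrite -leNgt; apply: le_trans up.
by rewrite ler_pM2l.
Qed.

Lemma card_le_II_inj T (A : set T) (f : T -> nat) k :
  {in A &, injective f} -> (forall x, A x -> (f x < k)%N) -> A #<= `I_k.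
Proof.
move=> f_inj f_lt; rewrite -(card_le_eql (inj_card_eq f_inj)).
by apply: subset_card_le => _ [x Ax <-]; exact: f_lt.
Qed.

Lemma counting_le (T : choiceType) (A : set T) k :
  A #<= `I_k -> (counting A <= (k%:R : R)%:E)%E.
Proof.
move=> Ak; rewrite /counting asboolT ?lee_fin ?ler_nat ?geq_card_fset_set//.
by apply/finite_set_leP; exists k.
Qed.

End Lattice.

(** * Separation of eigenvalues on a shell, and the window of shells *)

Section Multiplicity.
Context {R : realType} (r sigma : R).
Hypotheses (r_gt0 : 0 < r) (sigma_gt0 : 0 < sigma).

Local Notation gap := (@harmonic_gap R).
Let rho := 3 * r * sigma.
Let scaled (m n : nat) := 27 / 4 * r ^+ 2 * Lambda r sigma m n.

Let rho_gt0 : 0 < rho. Proof. by rewrite !mulr_gt0. Qed.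

Lemma Lambda_excess m n : exists X M N : R,
  [/\ 0 <= X < pi / 2, 0 <= M < pi / 2, 0 <= N < pi / 2,
      [/\ (2 * X + M + N + (m + n)%:R * pi) * tan X = rho,
          (2 * M - N + X + m%:R * pi) * tan M = rho &
          (2 * N - M + X + n%:R * pi) * tan N = rho] &
      scaled m n = pi ^+ 2 * (shell (m, n))%:R + excess m n X M N].
Proof.
have [L [M [N [phaseE [/andP[L1 L2] M_in N_in _ [eqL eqM eqN]]]]]] : exists L M N,
    phase r sigma m n = (L, M, N) /\ is_phase_triple r sigma m n (L, M, N).
  have [t ht] := is_phase_triple_exists m n r_gt0 sigma_gt0.
  case E : (phase r sigma m n) => [[L M] N]; exists L, M, N; split=> //.
  (* Existence of a triple excludes the default value of [xget]. *)
  by rewrite -E /phase; case: xgetP => [_ -> //|/(_ t)/(_ ht)].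
exists (- L), M, N; split=> //.
- by rewrite oppr_ge0 L2/= ltrNl.
- split.
  + by rewrite /rho -eqL tanN mulrN -mulNr; congr (_ * _); ring.
  + by rewrite /rho -eqM; congr (_ * _); ring.
  + by rewrite /rho -eqN; congr (_ * _); ring.
rewrite /scaled /Lambda phaseE /excess /shell/= !natrD natrM !natrX.
by move: (@pi R) (pi_gt0 R) => p p0; field; rewrite !gt_eqF.
Qed.

Lemma scaled_near_shell m n :
  `|scaled m n - pi ^+ 2 * (shell (m, n))%:R| <= 9 * rho + 27 / 2 * pi ^+ 2.
Proof.
have [X [M [N [X_in M_in N_in [eqX eqM eqN] ->]]]] := Lambda_excess m n.
by rewrite addrC addKr; exact: excess_bound.
Qed.

Let c1 := (rho + 3) * (rho / pi) ^+ 2.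
Let D := 9 * (rho ^+ 5 + 3 * rho ^+ 4) + 54 * rho * (4 * rho ^+ 2 + rho ^+ 3).

Let c1_gt0 : 0 < c1.
Proof. by rewrite mulr_gt0 ?addr_gt0 ?exprn_gt0 ?divr_gt0 ?pi_gt0. Qed.

Let D_ge0 : 0 <= D.
Proof.
have h k := exprn_ge0 k (ltW rho_gt0).
have -> : D = 9 * rho ^+ 5 + 81 * rho ^+ 4 + 216 * rho ^+ 3 by rewrite /D; ring.
by have := h 5; have := h 4; have := h 3; lra.
Qed.

(** As [1 / m <= gap m n], the error can be measured by the gap itself. *)
Lemma scaled_expansion m n : (0 < m)%N -> (m <= n)%N ->
  `|scaled m n - (pi ^+ 2 * (shell (m, n))%:R + 9 * rho)
    + c1 * gap m n ^+ 2| <= D * gap m n ^+ 4.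
Proof.
move=> m0 mn.
have [X [M [N [X_in M_in N_in [eqX eqM eqN] ->]]]] := Lambda_excess m n.
have /andP[gap_ge _] := @harmonic_gap_bounds R m n m0 mn.
rewrite opprD addrACA subrr add0r.
apply: le_trans (excess_expansion rho_gt0 X_in M_in N_in eqX eqM eqN m0 mn) _.
rewrite -/D ler_wpM2l// lerXn2r ?nnegrE ?invr_ge0//.
by apply: le_trans gap_ge; rewrite invr_ge0.
Qed.

Lemma Lambda_shell_inj : exists m0 : nat, forall m n m' n',
  (m0 <= m <= n)%N -> (m0 <= m' <= n')%N ->
  shell (m, n) = shell (m', n') -> Lambda r sigma m n = Lambda r sigma m' n' ->
  (m, n) = (m', n').
Proof.
have [k hk] : exists k : nat, 4 * D / c1 < k%:R.
  exists (Num.bound `|4 * D / c1|).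
  exact: le_lt_trans (ler_norm _) (archi_boundP (normr_ge0 _)).
(* The gap [T] is at most [2 / m]: [m >= 4] gives [T <= 1/2], and [m >= k > 4 D / c1] gives
   [2 D T < c1]. *)
exists (maxn 4 k) => m n m' n'.
rewrite !geq_max => /andP[/andP[m4 mk] mn] /andP[/andP[m4' mk'] mn'] eqQ eqLam.
have eqS : scaled m n = scaled m' n' by rewrite /scaled eqLam.
wlog : m n m' n' m4 mk mn m4' mk' mn' eqQ {eqLam} eqS / (m + n <= m' + n')%N.
  move=> wh; have [|/ltnW] := leqP (m + n) (m' + n'); first exact: wh.
  by move=> h; apply/esym; apply: wh.
rewrite leq_eqVlt => /predU1P[|lt_sum]; first exact: shell_sum_inj.
have m0 : (0 < m)%N by apply: leq_trans m4.
have m0' : (0 < m')%N by apply: leq_trans m4'.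
have n0 := leq_trans m0 mn; have n0' := leq_trans m0' mn'.
have := harmonic_gap_sep (R := R) m0 n0 m0' n0' eqQ lt_sum.
have := scaled_expansion m0' mn'; rewrite -eqS -eqQ.
have := scaled_expansion m0 mn.
have /andP[T_ge T_le] := @harmonic_gap_bounds R m n m0 mn.
have /andP[T_ge' _] := @harmonic_gap_bounds R m' n' m0' mn'.
have mR : 0 < m%:R :> R by rewrite ltr0n.
have mR' : 0 < m'%:R :> R by rewrite ltr0n.
have T0 := lt_le_trans (_ : 0 < m%:R^-1) T_ge.
have T0' := lt_le_trans (_ : 0 < m'%:R^-1) T_ge'.
rewrite !invr_gt0 in T0 T0'.
move=> exp exp' sep; exfalso.
apply: (expansion_separates c1_gt0 D_ge0 (T0 mR) (T0' mR') _ _ sep exp exp').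
  have m_inv : m%:R^-1 <= 4^-1 :> R by rewrite lef_pV2 ?posrE// ler_nat.
  by lra.
apply: (@le_lt_trans _ _ (2 * D * (2 * m%:R^-1))); first by rewrite ler_wpM2l// mulr_ge0.
rewrite [ltLHS](_ : _ = 4 * D / m%:R); last by field; rewrite gt_eqF.
rewrite ltr_pdivrMr// [ltRHS]mulrC -ltr_pdivrMr//; apply: lt_le_trans hk _.
by rewrite ler_nat.
Qed.

(** Both values [pi^2 Q] lie within [C] of the same number, and [pi^2 >= 1]. *)
Lemma contributing_shell_window : exists K : nat, forall lambda mn mn',
  contributing r sigma lambda mn -> contributing r sigma lambda mn' ->
  (shell mn <= shell mn' + K)%N.
Proof.
pose C := 9 * rho + 27 / 2 * pi ^+ 2.
have [K hK] : exists K : nat, 2 * C < K%:R.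
  exists (Num.bound `|2 * C|).
  exact: le_lt_trans (ler_norm _) (archi_boundP (normr_ge0 _)).
exists K => lambda [m n] [m' n'] [_ /= lam] [_ /= lam'].
have := scaled_near_shell m n; have := scaled_near_shell m' n'.
rewrite /scaled lam lam' -/C -(ler_nat R) natrD !ler_norml.
move=> /andP[? ?] /andP[? ?].
rewrite -lerBlDl; have [le|gt] := leP (shell (m, n))%:R ((shell (m', n'))%:R : R).
  by apply: (@le_trans _ _ 0); rewrite ?subr_le0.
have pi2 : 1 <= (pi : R) ^+ 2.
  by rewrite exprn_ege1//; have := @pihalf_ge1 R; lra.
have : ((shell (m, n))%:R - (shell (m', n'))%:R : R) <=
    pi ^+ 2 * ((shell (m, n))%:R - (shell (m', n'))%:R).
  by rewrite ler_peMl// subr_ge0 ltW.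
by lra.
Qed.

End Multiplicity.

(** * Coding the classes of an eigenvalue by integers *)

Unset Implicit Arguments.

Theorem theorem3p9 (R : realType) (r sigma : R) (r_gt0 : 0 < r)
    (sigma_gt0 : 0 < sigma) :
  exists B N : nat,
    (forall lambda : R, robin_spectrum r sigma lambda ->
       (forall Q : nat,
          [set mn | contributing r sigma lambda mn /\ shell mn = Q] #<= `I_B) /\
       shell @` contributing r sigma lambda #<= `I_N) /\
    (Ksup r sigma <= ((B * N)%:R : R)%:E < +oo)%E.
Proof.
have [m0 high_inj] := Lambda_shell_inj r_gt0 sigma_gt0.
have [K window] := contributing_shell_window r_gt0 sigma_gt0.
(* On a shell, [m < m0] determines the class, and at most one contributing class has [m >= m0];
   these get the common code [m0]. The codes 0 to [m0] give [B = m0 + 1]. *)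
pose f (mn : nat * nat) := minn mn.1 m0.
have f_inj lambda mn mn' : contributing r sigma lambda mn ->
    contributing r sigma lambda mn' -> shell mn = shell mn' -> f mn = f mn' ->
    mn = mn'.
  case: mn mn' => [m n] [m' n'] [/= mn lam] [/= mn' lam'] eqQ; rewrite /f/= => eqf.
  have [eqm|neqm] := eqVneq m m'.
    by rewrite -eqm in eqQ *; rewrite (shell_fst_inj eqQ).
  by apply: high_inj; rewrite ?mn ?mn' ?andbT// ?lam ?lam'//; lia.
(* The shells lie within [K] of any one of them, [q0]; adding [K] avoids truncated subtraction and
   leaves [2 K + 1] values. *)
have shift lambda : exists q0 : nat, forall mn, contributing r sigma lambda mn ->
    (q0 <= shell mn + K < q0 + (K + K).+1)%N.
  have [[mn0 c0]|none] := pselect (exists mn, contributing r sigma lambda mn).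
    exists (shell mn0) => mn c.
    by have := window _ _ _ c0 c; have := window _ _ _ c c0; lia.
  by exists 0%N => mn c; case: none; exists mn.
exists m0.+1, (K + K).+1; split.
  move=> lambda _; split=> [Q|].
    apply: (@card_le_II_inj _ _ f) => [mn mn'|mn _]; last by rewrite ltnS geq_minr.
    by rewrite !inE => -[c q] [c' q']; apply: f_inj c c' _; rewrite q q'.
  have [q0 hq0] := shift lambda.
  apply: (@card_le_II_inj _ _ (fun q => q + K - q0)%N) => [q q'|q]; last first.
    by move=> [mn /hq0 + <-]; lia.
  by rewrite !inE => -[mn /hq0 + <-] [mn' /hq0 + <-]; lia.
apply/andP; split; last exact: ltry.
apply: ge_ereal_sup => _ [lambda _ <-]; apply: counting_le.
have [q0 hq0] := shift lambda.
(* Mixed radix: [f] is the last digit in base [m0 + 1], recovered by reduction, and the shell index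
   is the leading part. *)
apply: (@card_le_II_inj _ _ (fun mn => f mn + (shell mn + K - q0) * m0.+1)%N).
  move=> mn mn'; rewrite !inE => c c' eq_code.
  have f_lt mn1 : (f mn1 < m0.+1)%N by rewrite ltnS geq_minr.
  have eqf : f mn = f mn'.
    rewrite -(modn_small (f_lt mn)) -(modn_small (f_lt mn')).
    by rewrite -(modnMDl (shell mn + K - q0)) addnC eq_code addnC modnMDl.
  apply: (f_inj _ _ _ c c' _ eqf); move: eq_code (hq0 _ c) (hq0 _ c').
  by rewrite eqf => /addnI/eqP; rewrite eqn_pmul2r// => /eqP; lia.
move=> mn c; have := hq0 _ c; have : (f mn <= m0)%N by rewrite geq_minr.
by move: (f mn) (shell mn) => a q; nia.
Qed.
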